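(* Let $S\subseteq\mathbb{R}$. Then the following are equivalent: (a) $S$ is closed. (b) For each $s\in\mathbb{R}$, if ${}^*S\cap\mu(s)\neq\varnothing$, then $s\in S$. (c) $S=\{s\in\mathbb{R}: {}^*S\cap\mu(s)\neq\varnothing\}$. (d) $S=\mathrm{st}({}^*S)$.
   Context: $\mathbb{R}_+$ is the set of positive real numbers and $\mathbb{N}=\{1,2,3,\dots\}$. Fix an ultrafilter $\mathcal{U}$ on $\mathbb{R}_+$ such that $(0,\tfrac1n)\in\mathcal{U}$ for all $n\in\mathbb{N}$. A property of $\varepsilon\in\mathbb{R}_+$ holds almost everywhere (a.e.) if the set of $\varepsilon$ for which it holds belongs to $\mathcal{U}$. For nets $(a_\varepsilon),(b_\varepsilon)\in\mathbb{C}^{\mathbb{R}_+}$ write $(a_\varepsilon)\sim(b_\varepsilon)$ if $a_\varepsilon=b_\varepsilon$ a.e.; $\langle a_\varepsilon\rangle$ is the equivalence class, and ${}^*\mathbb{C}=\mathbb{C}^{\mathbb{R}_+}/\!\sim$ with operations induced pointwise; $\mathbb{C}$ is embedded via constant nets. For $S\subseteq\mathbb{C}$, ${}^*S=\{\langle s_\varepsilon\rangle : s_\varepsilon\in S\text{ a.e.}\}$; in particular this defines ${}^*\mathbb{R}$, ordered by $\langle a_\varepsilon\rangle<\langle b_\varepsilon\rangle$ iff $a_\varepsilon<b_\varepsilon$ a.e. $\mathcal{I}({}^*\mathbb{R})=\{x\in{}^*\mathbb{R}: |x|<\tfrac1n\ \forall n\in\mathbb{N}\}$ and $\mathcal{F}({}^*\mathbb{R})=\{x\in{}^*\mathbb{R}:|x|\le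 n\text{ for some }n\in\mathbb{N}\}$. For $s\in\mathbb{R}$, the monad at $s$ is $\mu(s)=\{s+dx: dx\in\mathcal{I}({}^*\mathbb{R})\}$. For $x\in\mathcal{F}({}^*\mathbb{R})$, $\mathrm{st}(x)=\sup\{r\in\mathbb{R}:r\le x\}$; for $A\subseteq{}^*\mathbb{R}$, $\mathrm{st}(A)=\{\mathrm{st}(x): x\in A\cap\mathcal{F}({}^*\mathbb{R})\}$. Closed refers to the usual topology of $\mathbb{R}$. *)

(* Defs.v *)
From HB Require Import structures.
From mathcomp Require Import all_boot all_order all_algebra.
From mathcomp Require Import complex.
From mathcomp Require Import all_classical all_reals all_analysis.

Set Implicit Arguments.
Unset Strict Implicit.
Unset Printing Implicit Defensive.

Import Order.TTheory GRing.Theory Num.Theory.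
Import numFieldNormedType.Exports.
Local Open Scope classical_set_scope.
Local Open Scope ring_scope.
Local Open Scope complex_scope.
Local Open Scope quotient_scope.

(* The index set of nets is {posnum R}, so the set of e with e < 1/n is the
   interval (0, 1/n). *)
Record null_ultrafilter (R : realType) := NullUltrafilter {
  nuf_sets :> set {posnum R} -> Prop;
  nuf_ultra : @UltraFilter {posnum R} nuf_sets;
  nuf_null : forall n : nat, (0 < n)%N ->
    nuf_sets [set e | e%:num < n%:R^-1] }.

#[global] Existing Instance nuf_ultra.

Section Hypercomplex.
Variables (R : realType) (U : null_ultrafilter R).

Definition net := {posnum R} -> R[i].

HB.instance Definition _ := Choice.on net.

Definition net_eq (a b : net) : bool := `[< U [set e | a e = b e] >].

Lemma net_eq_refl : reflexive net_eq.
Proof. by move=> a; apply/asboolP; apply: filterE. Qed.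

Lemma net_eq_sym : symmetric net_eq.
Proof. by move=> a b; apply/asboolP/asboolP; apply: filterS => e /= ->. Qed.

Lemma net_eq_trans : transitive net_eq.
Proof.
move=> b a c /asboolP ab /asboolP bc; apply/asboolP.
by apply: filterS2 ab bc => e /= -> ->.
Qed.

Canonical net_eq_equiv := EquivRel net_eq net_eq_refl net_eq_sym net_eq_trans.

Definition hyperC := {eq_quot net_eq}.

HB.instance Definition _ := Choice.on hyperC.
HB.instance Definition _ := EqQuotient.on hyperC.

Lemma hyperC_eqP (a b : net) :
  \pi_hyperC a = \pi_hyperC b <-> U [set e | a e = b e].
Proof.
split; first by move/eqmodP => /asboolP.
by move=> ab; apply/eqmodP/asboolP.
Qed.

Lemma net_reprK (a : net) : U [set e | repr (\pi_hyperC a) e = a e].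
Proof. by apply/hyperC_eqP; rewrite reprK. Qed.

Definition hypC_cst (z : R[i]) : hyperC := \pi_hyperC (fun=> z).

Definition hypC_add (x y : hyperC) : hyperC :=
  \pi_hyperC (fun e => repr x e + repr y e).
Definition hypC_opp (x : hyperC) : hyperC := \pi_hyperC (fun e => - repr x e).
Definition hypC_mul (x y : hyperC) : hyperC :=
  \pi_hyperC (fun e => repr x e * repr y e).

Lemma hypC_addE (a b : net) :
  hypC_add (\pi_hyperC a) (\pi_hyperC b) = \pi_hyperC (fun e => a e + b e).
Proof.
by apply/hyperC_eqP; apply: filterS2 (net_reprK a) (net_reprK b) => e /= -> ->.
Qed.

Lemma hypC_oppE (a : net) :
  hypC_opp (\pi_hyperC a) = \pi_hyperC (fun e => - a e).
Proof. by apply/hyperC_eqP; apply: filterS (net_reprK a) => e /= ->. Qed.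

Lemma hypC_mulE (a b : net) :
  hypC_mul (\pi_hyperC a) (\pi_hyperC b) = \pi_hyperC (fun e => a e * b e).
Proof.
by apply/hyperC_eqP; apply: filterS2 (net_reprK a) (net_reprK b) => e /= -> ->.
Qed.

Lemma hypC_addA : associative hypC_add.
Proof.
move=> x y z; elim/quotW: x => a; elim/quotW: y => b; elim/quotW: z => c.
rewrite (hypC_addE a b) (hypC_addE b c) !hypC_addE.
by apply/hyperC_eqP; apply: filterE => e /=; rewrite addrA.
Qed.

Lemma hypC_addC : commutative hypC_add.
Proof.
move=> x y; elim/quotW: x => a; elim/quotW: y => b; rewrite !hypC_addE.
by apply/hyperC_eqP; apply: filterE => e /=; rewrite addrC.
Qed.

Lemma hypC_add0 : left_id (hypC_cst 0) hypC_add.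
Proof.
move=> x; elim/quotW: x => a; rewrite hypC_addE.
by apply/hyperC_eqP; apply: filterE => e /=; rewrite add0r.
Qed.

Lemma hypC_addN : left_inverse (hypC_cst 0) hypC_opp hypC_add.
Proof.
move=> x; elim/quotW: x => a; rewrite hypC_oppE hypC_addE.
by apply/hyperC_eqP; apply: filterE => e /=; rewrite addNr.
Qed.

HB.instance Definition _ := GRing.isZmodule.Build hyperC
  hypC_addA hypC_addC hypC_add0 hypC_addN.

Lemma hypC_mulA : associative hypC_mul.
Proof.
move=> x y z; elim/quotW: x => a; elim/quotW: y => b; elim/quotW: z => c.
rewrite (hypC_mulE a b) (hypC_mulE b c) !hypC_mulE.
by apply/hyperC_eqP; apply: filterE => e /=; rewrite mulrA.
Qed.

Lemma hypC_mulC : commutative hypC_mul.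
Proof.
move=> x y; elim/quotW: x => a; elim/quotW: y => b; rewrite !hypC_mulE.
by apply/hyperC_eqP; apply: filterE => e /=; rewrite mulrC.
Qed.

Lemma hypC_mul1 : left_id (hypC_cst 1) hypC_mul.
Proof.
move=> x; elim/quotW: x => a; rewrite hypC_mulE.
by apply/hyperC_eqP; apply: filterE => e /=; rewrite mul1r.
Qed.

Lemma hypC_mulDl : left_distributive hypC_mul hypC_add.
Proof.
move=> x y z; elim/quotW: x => a; elim/quotW: y => b; elim/quotW: z => c.
rewrite (hypC_addE a b) (hypC_mulE a c) (hypC_mulE b c) hypC_mulE hypC_addE.
by apply/hyperC_eqP; apply: filterE => e /=; rewrite mulrDl.
Qed.

Lemma hypC_1neq0 : hypC_cst 1 != hypC_cst 0.
Proof.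
apply/eqP => /hyperC_eqP /filter_ex[e /= /eqP].
by rewrite oner_eq0.
Qed.

HB.instance Definition _ := GRing.Zmodule_isComNzRing.Build hyperC
  hypC_mulA hypC_mulC hypC_mul1 hypC_mulDl hypC_1neq0.

(* The value is the class of a nonnegative real net, as `|z| : R[i] is. *)
Definition hypC_abs (x : hyperC) : hyperC := \pi_hyperC (fun e => `|repr x e|).

Lemma hypC_absE (a : net) :
  hypC_abs (\pi_hyperC a) = \pi_hyperC (fun e => `|a e|).
Proof. by apply/hyperC_eqP; apply: filterS (net_reprK a) => e /= ->. Qed.

(* The order of R[i] compares z and w when they have equal imaginary parts; on
   real numbers it is the usual order, so that this is the order of *R when x
   and y lie in hyperR below. *)
Definition hyp_lt (x y : hyperC) : Prop := U [set e | repr x e < repr y e].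

Lemma hyp_ltE (a b : net) :
  hyp_lt (\pi_hyperC a) (\pi_hyperC b) <-> U [set e | a e < b e].
Proof.
have Ha := net_reprK a; have Hb := net_reprK b.
by split=> ab; apply: filterS3 Ha Hb ab => e /= -> ->.
Qed.

Definition hyp_le (x y : hyperC) : Prop := x = y \/ hyp_lt x y.

Definition star (S : set R[i]) : set hyperC :=
  [set \pi_hyperC a | a in [set a : net | U [set e | S (a e)]]].

Definition starR (S : set R) : set hyperC := star [set r%:C | r in S].

Definition hyperR : set hyperC := starR setT.

Definition hypR_cst (r : R) : hyperC := hypC_cst r%:C.

Definition infinitesimal : set hyperC :=
  [set x | hyperR x /\
    forall n : nat, (0 < n)%N -> hyp_lt (hypC_abs x) (hypR_cst n%:R^-1)].

Definition finite_hyperR : set hyperC :=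
  [set x | hyperR x /\
    exists2 n : nat, (0 < n)%N & hyp_le (hypC_abs x) (hypR_cst n%:R)].

Definition monad (s : R) : set hyperC :=
  [set hypR_cst s + dx | dx in infinitesimal].

(* The supremum is taken in R; only the values on finite_hyperR matter. *)
Definition st (x : hyperC) : R := sup [set r : R | hyp_le (hypR_cst r) x].

Definition st_set (A : set hyperC) : set R := st @` (A `&` finite_hyperR).

End Hypercomplex.

Arguments star {R} U S _.
Arguments starR {R} U S _.
Arguments hyperR {R} U _.
Arguments infinitesimal {R} U _.
Arguments finite_hyperR {R} U _.
Arguments monad {R} U s _.

(* Main.v *)
Require Import Defs.
From mathcomp Require Import all_boot all_order all_algebra.
From mathcomp Require Import complex.
From mathcomp Require Import all_classical all_reals all_analysis.
Import Order.TTheory GRing.Theory Num.Theory.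
Import numFieldNormedType.Exports.
Local Open Scope classical_set_scope.
Local Open Scope ring_scope.

(** A hyperreal is the class of a real net [a], and it lies in the monad of [s]
    exactly when [a] converges to [s] along the ultrafilter. In these terms, (b)
    says that [S] contains the limits of the nets in [S] that converge along
    [U]; such limits fill the closure of [S], because [U] contains the intervals
    (0, 1/n), so that a net with [|a e - s| < e] converges to [s]. A finite net
    stays in a compact interval, hence converges along the ultrafilter, and its
    limit is its standard part; so (c) and (d) describe the same set. *)

Definition hyper_of {R : realType} (U : null_ultrafilter R)
    (a : {posnum R} -> R) : hyperC U :=
  \pi_(hyperC U)%qT (fun e => (a e)%:C%C).

Lemma normc_real {R : rcfType} (x : R) : `|x%:C%C| = `|x|%:C%C.
Proof. by rewrite normc_def /= expr0n addr0 sqrtr_sqr. Qed.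

Section HyperReals.
Variables (R : realType) (U : null_ultrafilter R).
Local Notation UF := (nuf_sets U : set_system {posnum R}).
Implicit Types (S : set R) (a : {posnum R} -> R) (s : R).

Lemma hyper_of_eqP a b :
  hyper_of U a = hyper_of U b <-> U [set e | a e = b e].
Proof.
rewrite /hyper_of hyperC_eqP.
by split; apply: filterS => e /=; [exact: complexI|move=> ->].
Qed.

Lemma hypR_cstE s : hypR_cst U s = hyper_of U (fun=> s).
Proof. by []. Qed.

Lemma hyper_of_ltP a b :
  hyp_lt (hyper_of U a) (hyper_of U b) <-> U [set e | a e < b e].
Proof.
rewrite /hyper_of hyp_ltE.
by split; apply: filterS => e /=; rewrite ltcR.
Qed.

(** [hyp_le] is a disjunction between classes, while [a e <= b e] is one at each index. The two
    agree because an ultrafilter contains the set where [a e = b e] or its complement. *)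
Lemma hyper_of_leP a b :
  hyp_le (hyper_of U a) (hyper_of U b) <-> U [set e | a e <= b e].
Proof.
rewrite /hyp_le hyper_of_eqP hyper_of_ltP; split.
  by case; apply: filterS => e /=; [move=> ->|exact: ltW].
move=> ab; have [|nab] := in_ultra_setVsetC [set e | a e = b e] (nuf_ultra U).
  by left.
right; apply: filterS2 ab nab => e /= ab /eqP nab.
by rewrite lt_neqAle nab.
Qed.

Lemma hyper_of_abs a : hypC_abs (hyper_of U a) = hyper_of U (fun e => `|a e|).
Proof.
rewrite /hyper_of hypC_absE; apply/hyperC_eqP; apply: filterE => e /=.
exact: normc_real.
Qed.

Lemma hyper_of_cstD s a :
  hypR_cst U s + hyper_of U a = hyper_of U (fun e => s + a e).
Proof.
rewrite /hyper_of /hypR_cst /hypC_cst [LHS]hypC_addE; apply/hyperC_eqP.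
by apply: filterE => e /=; rewrite rmorphD.
Qed.

Lemma starRP S x :
  starR U S x <-> exists2 a, x = hyper_of U a & U [set e | S (a e)].
Proof.
split=> [[z Uz <-]|[a -> Ua]]; last first.
  by exists (fun e => (a e)%:C%C) => //; apply: filterS Ua => e /= Sa; exists (a e).
(* The net [z] is real only almost everywhere; its real part is real at every index and represents
   the same class. *)
exists (fun e => complex.Re (z e)).
  by apply/hyperC_eqP; apply: filterS Uz => e /= [r _ <-].
by apply: filterS Uz => e /= [r Sr <-].
Qed.

Lemma hyperR_hyper_of a : hyperR U (hyper_of U a).
Proof. by apply/starRP; exists a => //; apply: filterE. Qed.

Lemma infinitesimalP a :
  infinitesimal U (hyper_of U a) <-> a @ UF --> 0.
Proof.
split=> [[_ a0]|a0].
  apply/cvgr0Pnorm_lt => eps /ltr_add_invr[k]; rewrite add0r => keps.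
  have := a0 k.+1 isT; rewrite hyper_of_abs hypR_cstE hyper_of_ltP.
  by apply: filterS => e /= ak; exact: lt_trans ak keps.
split=> [|n n0]; first exact: hyperR_hyper_of.
rewrite hyper_of_abs hypR_cstE hyper_of_ltP.
by move/cvgr0Pnorm_lt : a0; apply; rewrite invr_gt0 ltr0n.
Qed.

Lemma monadP s a : monad U s (hyper_of U a) <-> a @ UF --> s.
Proof.
split=> [[dx dx0 dxa]|as_].
  case: (dx0) => /starRP[d dxE _] _; rewrite dxE in dx0 dxa.
  move/infinitesimalP : dx0 => d0.
  move: dxa; rewrite hyper_of_cstD => /hyper_of_eqP dxa.
  (* The nets [a] and [s + d] agree only almost everywhere, which is enough to share limits along
     [U]. *)
  apply: (@cvg_trans _ ((fun e => s + d e) @ UF)).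
    exact: near_eq_cvg.
  by have := cvgD (cvg_cst s) d0; rewrite addr0; apply.
exists (hyper_of U (fun e => a e - s)).
  by apply/infinitesimalP; rewrite -(subrr s); apply: cvgB => //; exact: cvg_cst.
rewrite hyper_of_cstD; congr hyper_of.
by apply/funext => e; rewrite addrC subrK.
Qed.

Lemma monad_starRP S s :
  starR U S `&` monad U s !=set0 <->
  exists2 a, U [set e | S (a e)] & a @ UF --> s.
Proof.
split=> [[x [/starRP[a -> Sa] /monadP ?]]|[a Sa /monadP ?]]; first by exists a.
by exists (hyper_of U a); split=> //; apply/starRP; exists a.
Qed.

Lemma finite_hyperRP a :
  finite_hyperR U (hyper_of U a) <-> exists s, a @ UF --> s.
Proof.
split=> [[_ [n n0]]|[s as_]]; last first.
  split; first exact: hyperR_hyper_of.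
  (* Almost everywhere [a e] is within 1 of [s], so any integer above [|s| + 1] is a bound. *)
  exists (Num.truncn (`|s| + 1)).+1 => //.
  rewrite hyper_of_abs hypR_cstE hyper_of_leP.
  have /cvgrPdist_lt/(_ _ ltr01) := as_.
  apply: filterS => e /= sa; apply/ltW/(le_lt_trans _ (truncnS_gt _)).
  rewrite -[a e](subKr s) (le_trans (ler_normB _ _))// lerD2l.
  exact: ltW.
rewrite hyper_of_abs hypR_cstE hyper_of_leP => an.
(* Compactness gives only a cluster point. It is a limit: were the preimage of a neighbourhood [V]
   not in [U], that of [~] V[would be, and]~[V] would have to meet [V]. *)
have [|s [_ clus]] := @segment_compact R (- n%:R) n%:R (a @ UF) _.
  by apply: filterS an => e /=; rewrite ler_norml in_itv.
exists s => V sV.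
have [//|nV] := in_ultra_setVsetC (a @^-1` V) (nuf_ultra U).
by have [x []] := clus (~` V) V nV sV.
Qed.

(** The set under the supremum contains every [r < s] and no [r > s]; whether it contains [s]
    depends on the net, but the supremum does not. *)
Lemma st_lim a s : a @ UF --> s -> st (hyper_of U a) = s.
Proof.
move=> as_; rewrite /st; set A := [set r | _].
have below r : r < s -> A r.
  move=> rs; rewrite /A /= hypR_cstE hyper_of_leP.
  by apply: filterS (cvgr_gt s as_ r rs) => e /ltW.
have As : ubound A s.
  move=> r; rewrite /A /= hypR_cstE hyper_of_leP leNgt => ra; apply/negP => sr.
  have [e [/= rae]] := filter_ex (filterI ra (cvgr_lt s as_ r sr)).
  by rewrite ltNge rae.
have A0 : A !=set0 by exists (s - 1); apply: below; rewrite ltrBlDr ltrDl.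
apply/eqP; rewrite eq_le ge_sup//=; apply/ler_addgt0Pr => eps eps0.
rewrite -lerBlDr ub_le_sup//; first by exists s.
by apply: below; rewrite ltrBlDr ltrDl.
Qed.

Lemma st_set_starR S :
  st_set (starR U S) = [set s | starR U S `&` monad U s !=set0].
Proof.
apply/seteqP; split=> [s [x [/starRP[a -> Sa] /finite_hyperRP[t at_]] <-]|s] /=.
  by apply/monad_starRP; exists a; rewrite // (st_lim _ _ at_).
move=> /monad_starRP[a Sa as_]; exists (hyper_of U a); last exact: st_lim.
by split; [apply/starRP; exists a|apply/finite_hyperRP; exists s].
Qed.

Lemma closureP S s :
  closure S s <-> exists2 a, U [set e | S (a e)] & a @ UF --> s.
Proof.
split=> [Ss|[a Sa]]; last first.
  by apply: closed_cvg; [exact: closed_closure|apply: filterS Sa => e /subset_closure].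
(* The index [e] itself serves as the radius of approximation. *)
have /choice[a aP] : forall e : {posnum R}, exists r, S r /\ `|s - r| < e%:num.
  move=> e; have [r [Sr]] := Ss _ (nbhsx_ballx s e%:num (gt0 e)).
  by exists r.
exists a; first by apply: filterE => e; case: (aP e).
apply/cvgrPdist_lt => eps /ltr_add_invr[k]; rewrite add0r => keps.
apply: filterS (nuf_null U (ltn0Sn k)) => e /= ek.
exact: lt_trans (aP e).2 (lt_trans ek keps).
Qed.

End HyperReals.

Theorem theorem3p3p6 (R : realType) (U : null_ultrafilter R) (S : set R) :
  [<-> closed S;
       forall s : R, starR U S `&` monad U s !=set0 -> S s;
       S = [set s : R | starR U S `&` monad U s !=set0];
       S = st_set (starR U S)].
Proof.
have monadS s : starR U S `&` monad U s !=set0 <-> closure S s.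
  by rewrite monad_starRP (closureP _ U).
have starE : [set s : R | starR U S `&` monad U s !=set0] = closure S.
  by apply/funext => s; apply/propext; exact: monadS.
(* Both (c) and (d) now read [S = closure S]. *)
rewrite st_set_starR starE; tfae => //.
- by move=> clS s /monadS /clS.
- move=> SP; apply/closure_id => s /monadS; exact: SP.
- by move/closure_id.
Qed.
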